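(* Let $n \ge 3$, let $T \subset \mathbb{R}^2$ be a convex, non-degenerate $n$-gon with vertices $\mathbf{x}_1,\dots,\mathbf{x}_n$, and let $K_T \subset \mathbb{R}^2$ be the reference polygon associated with $T$, i.e. $$K_T = U_T\begin{bmatrix} \mathbf{v}_{1,T}^t \\ \mathbf{v}_{2,T}^t \end{bmatrix}(S_{n-1}),$$ where $S_{n-1}$ is the standard simplex in $\mathbb{R}^n$ and $U_T, \mathbf{v}_{1,T}, \mathbf{v}_{2,T}$ come from a singular value decomposition of the centered vertex matrix $B_T$ of $T$ (as defined in the context). Then the in-radius of $K_T$ is greater than or equal to $\sqrt{\frac{1}{n(n-1)}}$, and the outer-radius of $K_T$ is less than or equal to $\sqrt{\frac{n-1}{n}}$. Consequently, the ratio $\rho$ between the outer-radius and the in-radius of $K_T$ satisfies $$1 \le \rho \le n-1 .$$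
   Context: An $n$-gon is a (closed) polygon in $\mathbb{R}^2$ with $n$ vertices. A polygon is non-degenerate if no three of its vertices lie on the same line. For a polygon, its in-radius is the maximum radius of all disks contained inside it, and its outer-radius is the minimum radius of all disks containing it. The simplex $S_{n-1}$ is $$S_{n-1} = \Big\{ [\lambda_1,\dots,\lambda_n]^t \in \mathbb{R}^n \;\Big|\; \sum_{i=1}^n \lambda_i = 1,\ \lambda_i \ge 0 \text{ for } 1\le i\le n\Big\}.$$ For an $n$-gon $T$ with vertices $\mathbf{x}_1,\dots,\mathbf{x}_n\in\mathbb{R}^2$ (column vectors), let $\mathbf{x}_T = \frac1n\sum_{i=1}^n \mathbf{x}_i$ be its arithmetic center and let $$B_T = [\mathbf{x}_1-\mathbf{x}_T,\ \mathbf{x}_2-\mathbf{x}_T,\ \cdots,\ \mathbf{x}_n-\mathbf{x}_T] \in \mathbb{R}^{2\times n}.$$ Let $B_T = U_T \Sigma_T V_T^t$ be a singular value decomposition, where $U_T\in\mathbb{R}^{2\times 2}$ and $V_T = [\mathbf{v}_{1,T}\ \mathbf{v}_{2,T}\ \cdots\ \mathbf{v}_{n,T}]\in\mathbb{R}^{n\times n}$ are orthogonal matrices, and $$\Sigma_T = \begin{bmatrix}\sigma_{1,T}& 0 & 0 & \cdots & 0 \\ 0 & \sigma_{2,T} & 0 & \cdots & 0\end{bmatrix}\in\mathbb{R}^{2\times n},\qquad \sigma_{1,T}\ge\sigma_{2,T},$$ with both singular values positive when $T$ is non-degenerate. Set $P_T = U_T\begin{bmatrix} \mathbf{v}_{1,T}^t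 \\ \mathbf{v}_{2,T}^t \end{bmatrix}\in\mathbb{R}^{2\times n}$, so that $B_T = \big(U_T\,\mathrm{diag}(\sigma_{1,T},\sigma_{2,T})\,U_T^t\big)P_T$. The set $K_T = P_T(S_{n-1}) = \{P_T\boldsymbol{\lambda} : \boldsymbol{\lambda}\in S_{n-1}\}$ is an $n$-gon in $\mathbb{R}^2$. *)

(* Defs.v *)
From mathcomp Require Import all_boot all_order all_algebra.
From mathcomp Require Import all_classical all_reals.

Set Implicit Arguments.
Unset Strict Implicit.
Unset Printing Implicit Defensive.

Import Order.TTheory GRing.Theory Num.Theory.

Local Open Scope classical_set_scope.
Local Open Scope ring_scope.

Section Plane.
Context {R : realType}.
Implicit Types (A : set 'cV[R]_2) (a b c p : 'cV[R]_2) (r : R).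

(* The norm [`|v|] provided by MathComp-Analysis on matrices is the sup norm,
   hence an explicit Euclidean norm. *)
Definition enorm (v : 'cV[R]_2) : R := Num.sqrt (\sum_(i < 2) v i 0 ^+ 2).

Definition disk c r : set 'cV[R]_2 := [set p : 'cV[R]_2 | enorm (p - c) <= r].

Definition is_in_radius A r : Prop :=
  let radii := [set s : R | 0 <= s /\ exists c, disk c s `<=` A] in
  radii r /\ ubound radii r.

Definition is_outer_radius A r : Prop :=
  let radii := [set s : R | 0 <= s /\ exists c, A `<=` disk c s] in
  radii r /\ lbound radii r.

Definition collinear a b c : Prop :=
  exists p d : 'cV[R]_2, d != 0 /\
    forall q, q \in [:: a; b; c] -> exists t : R, q = p + t *: d.

Definition extreme_point A p : Prop :=
  A p /\ forall a b (t : R), A a -> A b -> 0 < t < 1 ->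
    p = (1 - t) *: a + t *: b -> a = p /\ b = p.

End Plane.

Section Polygons.
Context {R : realType} {n : nat}.
Implicit Types (T : set 'cV[R]_2) (x : 'I_n -> 'cV[R]_2).

Definition simplex : set 'cV[R]_n :=
  [set l : 'cV[R]_n | \sum_(i < n) l i 0 = 1 /\ forall i, 0 <= l i 0].

(* [T] is the closed convex region spanned by the [x i], and the [x i] are [n]
   distinct genuine vertices of it (none is redundant).  The labelling of the
   vertices is arbitrary. *)
Definition convex_ngon T x : Prop :=
  [/\ injective x,
      T = [set \sum_(i < n) l i 0 *: x i | l in simplex]
    & forall i, extreme_point T (x i)].

Definition nondegenerate_ngon x : Prop :=
  forall i j k, i != j -> j != k -> i != k -> ~ collinear (x i) (x j) (x k).

Definition arith_center x : 'cV[R]_2 := n%:R^-1 *: \sum_(i < n) x i.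

Definition centered_mx x : 'M[R]_(2, n) :=
  \matrix_(i < 2, j < n) (x j - arith_center x) i 0.

Definition Sigma_mx (s1 s2 : R) : 'M[R]_(2, n) :=
  \matrix_(i < 2, j < n)
    if i == j :> nat then (if i == 0 then s1 else s2) else 0.

Definition ref_mx (n_ge2 : (2 <= n)%N) (U : 'M[R]_2) (V : 'M[R]_n) :
    'M[R]_(2, n) :=
  U *m \matrix_(i < 2) (col (widen_ord n_ge2 i) V)^T.

Definition ref_polygon (n_ge2 : (2 <= n)%N) (U : 'M[R]_2) (V : 'M[R]_n) :
    set 'cV[R]_2 :=
  [set ref_mx n_ge2 U V *m l | l in simplex].

End Polygons.

Definition orthogonal_mx (R : realType) (m : nat) (A : 'M[R]_m) : Prop :=
  A^T *m A = 1%:M.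

Definition is_svd (R : realType) (n : nat) (B : 'M[R]_(2, n))
    (U : 'M[R]_2) (s1 s2 : R) (V : 'M[R]_n) : Prop :=
  [/\ orthogonal_mx U, orthogonal_mx V, 0 <= s2 <= s1
    & B = U *m Sigma_mx s1 s2 *m V^T].

(* Main.v *)
(* Since [B_T] has zero row sums and positive singular values, [P := P_T] satisfies
   [P P^t = 1] and [P 1 = 0].  Hence every column of [P] has squared norm at most
   [1 - 1/n], so [K_T] lies in the disk of squared radius [(n-1)/n] around [0].
   Conversely [y = P (1/n + P^t y)], and the entries of [1/n + P^t y] are
   nonnegative as soon as [|y|^2 <= 1 / (n (n-1))], so [K_T] contains the disk of
   that squared radius.  That the two radii are attained follows from the
   compactness of [K_T]. *)
Require Import Defs.
From mathcomp Require Import all_boot all_order all_algebra.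
From mathcomp Require Import all_classical all_reals.
From mathcomp Require Import topology normedtype realfun derive.
From mathcomp Require Import ring lra.

Set Implicit Arguments.
Unset Strict Implicit.
Unset Printing Implicit Defensive.

Import Order.TTheory GRing.Theory Num.Theory.
Import numFieldNormedType.Exports.

Local Open Scope classical_set_scope.
Local Open Scope ring_scope.

Lemma sum_continuous (R : realType) (V : normedModType R) (T : topologicalType)
    n (f : 'I_n -> T -> V) :
  (forall i, continuous (f i)) -> continuous (fun t => \sum_(i < n) f i t).
Proof.
by move=> cf; apply: continuous_big => [|i _]; [exact: add_continuous|exact: cf].
Qed.

(** * Euclidean norm and disks in the plane *)

Section EuclideanNorm.
Context {R : realType}.
Implicit Types (v : 'cV[R]_2) (a : R).

Lemma enorm_ge0 v : 0 <= enorm v.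
Proof. exact: sqrtr_ge0. Qed.

Lemma sqr_enorm v : enorm v ^+ 2 = \sum_(i < 2) v i 0 ^+ 2.
Proof. by rewrite sqr_sqrtr// sumr_ge0// => i _; exact: sqr_ge0. Qed.

Lemma enormZ a v : enorm (a *: v) = `|a| * enorm v.
Proof.
rewrite /enorm; under eq_bigr do rewrite mxE exprMn.
by rewrite -mulr_sumr sqrtrM ?sqr_ge0// sqrtr_sqr.
Qed.

Lemma enorm0 : enorm (0 : 'cV[R]_2) = 0.
Proof. by rewrite -(scale0r (0 : 'cV[R]_2)) enormZ normr0 mul0r. Qed.

Lemma coord_le_enorm v i : `|v i 0| <= enorm v.
Proof.
rewrite -sqrtr_sqr ler_wsqrtr// (bigD1 i)//= lerDl sumr_ge0// => j _.
exact: sqr_ge0.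
Qed.

Lemma enorm_eq0 v : enorm v <= 0 -> v = 0.
Proof.
move=> v0; apply/colP => i; rewrite mxE; apply/normr0_eq0/eqP.
by rewrite eq_le normr_ge0 (le_trans (coord_le_enorm v i)).
Qed.

Lemma enorm_continuous : continuous (@enorm R).
Proof.
have cs : continuous (fun v : 'cV[R]_2 => \sum_(i < 2) v i 0 ^+ 2).
  apply: (sum_continuous (V := R^o)) => i w.
  apply: (continuous_comp (f := fun v : 'cV[R]_2 => v i 0) (g := fun a => a ^+ 2)).
    exact: coord_continuous.
  exact: exprn_continuous.
move=> v; apply: (continuous_comp (cs v)); exact: sqrt_continuous.
Qed.

(** The two points of the inner disk at distance [s] left and right of [c] have first coordinates
    [2 s] apart, and both lie within [s'] of that of [c']. *)
Lemma disk_radius_le c c' (s s' : R) :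
  0 <= s -> disk c s `<=` disk c' s' -> s <= s'.
Proof.
move=> s0 sub; pose e : 'cV[R]_2 := delta_mx 0 0.
have e1 : enorm e = 1.
  by rewrite /enorm big_ord_recl big_ord1 !mxE/= expr1n expr0n addr0 sqrtr1.
have inD t : `|t| = s -> `|c 0 0 - c' 0 0 + t| <= s'.
  move=> ts; have /sub : disk c s (c + t *: e).
    by rewrite /disk/= addrAC subrr add0r enormZ e1 ts mulr1.
  by move/(le_trans (coord_le_enorm _ 0)); rewrite !mxE/= mulr1 addrAC.
have := inD s (ger0_norm s0); have := inD (- s).
rewrite normrN => /(_ (ger0_norm s0)).
by rewrite !ler_norml => /andP[? ?] /andP[? ?]; lra.
Qed.

(** Indexing by the fixed unit disk turns containment into an intersection of conditions, each
    closed in [(c, s)] when [K] is closed. *)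
Lemma disk_subP (K : set 'cV[R]_2) c (s : R) : 0 <= s ->
  disk c s `<=` K <-> forall u, enorm u <= 1 -> K (c + s *: u).
Proof.
move=> s0; split=> [sub u u1|sub q qc].
  by apply: sub; rewrite /disk/= addrAC subrr add0r enormZ ger0_norm// ler_piMr.
move: s0; rewrite le_eqVlt => /predU1P[s0|s0].
  have qE : q - c = 0 by apply: enorm_eq0; rewrite s0.
  have := sub 0; rewrite scaler0 addr0 -(subrK c q) qE add0r; apply.
  by rewrite enorm0.
have := sub (s^-1 *: (q - c)); rewrite scalerA mulfV ?gt_eqF// scale1r.
rewrite subrKC; apply.
by rewrite enormZ gtr0_norm ?invr_gt0// mulrC ler_pdivrMr// mul1r.
Qed.

End EuclideanNorm.

(** * Compactness of boxes and of simplex images *)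

Section Compactness.
Context {R : realType}.

Lemma lincomb_continuous (V : normedModType R) n (p : 'I_n -> V) :
  continuous (fun v : 'rV[R]_n => \sum_(i < n) v 0 i *: p i).
Proof.
apply: sum_continuous => i w.
by apply: continuousZr_tmp; exact: coord_continuous.
Qed.

Lemma cV_box_compact n (M : R) :
  compact [set v : 'cV[R]_n | forall i, `|v i 0| <= M].
Proof.
pose f (v : 'rV[R]_n) : 'cV[R]_n := \sum_(i < n) v 0 i *: delta_mx i 0.
have fE v i : f v i 0 = v 0 i.
  rewrite summxE (bigD1 i)//= big1 ?addr0 => [|j ji].
    by rewrite !mxE !eqxx mulr1.
  by rewrite !mxE eq_sym (negPf ji) mulr0.
have -> : [set v : 'cV[R]_n | forall i, `|v i 0| <= M] =
    f @` [set v : 'rV[R]_n | forall i, `[- M, M]%classic (v 0 i)].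
  apply/seteqP; split=> [v vM|_ [v vM <-] i].
    exists v^T; first by move=> i; rewrite /= mxE in_itv/= -ler_norml.
    by apply/colP => i; rewrite fE mxE.
  by rewrite fE ler_norml; have := vM i; rewrite /= in_itv.
apply: continuous_compact.
  by apply: continuous_subspaceT; exact: lincomb_continuous.
exact: (rV_compact (fun=> @segment_compact R _ _)).
Qed.

Lemma closed_preimage_le (T : topologicalType) (f g : T -> R) :
  continuous f -> continuous g -> closed [set t | f t <= g t].
Proof.
move=> cf cg; have -> : [set t | f t <= g t] =
    (fun t => f t - g t) @^-1` [set x | x <= 0].
  by apply/seteqP; split=> t /=; rewrite subr_le0.
apply: preimage_closed; last exact: closed_le.
by move=> t _; apply: cvgB; [exact: cf|exact: cg].
Qed.

Lemma simplex_image_compact (V : normedModType R) n (p : 'I_n -> V) :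
  compact [set \sum_(i < n) l i 0 *: p i | l in @simplex R n].
Proof.
(* The simplex as row vectors: a closed subset of the cube [[0, 1]^n]. Its equation is split into
   two inequalities so that each piece is closed by [closed_preimage_le]. *)
pose S := [set v : 'rV[R]_n | \sum_(i < n) v 0 i <= 1] `&`
  [set v | 1 <= \sum_(i < n) v 0 i] `&` \bigcap_i [set v | 0 <= v 0 i].
have cs : continuous (fun v : 'rV[R]_n => \sum_(i < n) v 0 i).
  apply: (sum_continuous (V := R^o)) => i.
  exact: coord_continuous.
have -> : [set \sum_(i < n) l i 0 *: p i | l in @simplex R n] =
    (fun v : 'rV[R]_n => \sum_(i < n) v 0 i *: p i) @` S.
  apply/seteqP; split=> _ [l [l1 l0] <-].
    exists l^T; last by apply: eq_bigr => i _; rewrite mxE.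
    split; last by move=> i _; rewrite /= mxE.
    by split=> /=; under eq_bigr do rewrite mxE; rewrite l1.
  exists l^T; last by apply: eq_bigr => i _; rewrite mxE.
  split; last by move=> i; rewrite mxE; exact: l0.
  by under eq_bigr do rewrite mxE; apply/eqP; rewrite eq_le; apply/andP.
apply: continuous_compact.
  by apply: continuous_subspaceT; exact: lincomb_continuous.
have cbox : compact [set v : 'rV[R]_n | forall i, `[0, 1]%classic (v 0 i)].
  exact: (rV_compact (fun=> @segment_compact R _ _)).
apply: (subclosed_compact _ cbox).
  apply: closedI; first apply: closedI.
  - by apply: closed_preimage_le; [exact: cs|exact: cst_continuous].
  - by apply: closed_preimage_le; [exact: cst_continuous|exact: cs].
  - apply: closed_bigI => i _.
    by apply: closed_preimage_le; [exact: cst_continuous|exact: coord_continuous].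
move=> v [[v1 _] v0] i; rewrite /= in_itv/= [0 <= _]v0//= (le_trans _ v1)//.
by rewrite (bigD1 i)//= lerDl sumr_ge0// => j _; exact: v0.
Qed.

End Compactness.

(** * Existence of the in-radius and the outer-radius *)

Section Radii.
Context {R : realType}.
Implicit Types K : set 'cV[R]_2.

Lemma enorm_center_continuous (p : 'cV[R]_2) :
  continuous (fun z : 'cV[R]_2 * R => enorm (p - z.1)).
Proof.
move=> z; apply: (continuous_comp (f := fun z : 'cV[R]_2 * R => p - z.1)).
  by apply: cvgB; [exact: cvg_cst|exact: cvg_fst].
exact: enorm_continuous.
Qed.

Lemma snd_continuous (T U : topologicalType) : continuous (@snd T U).
Proof. by move=> z; exact: cvg_snd. Qed.

(** The pairs (center, radius) of disks inside [K] form a compact set, on which the radius attains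
    its maximum. *)
Lemma compact_in_radius K : compact K -> K !=set0 -> exists r, is_in_radius K r.
Proof.
move=> cK [p0 Kp0].
have [p1 Kp1 p1max] : exists2 p1, p1 \in K & forall t, t \in K -> enorm t <= enorm p1.
  apply: compact_EVT_max => //; first by exists p0.
  by apply: continuous_subspaceT; exact: enorm_continuous.
set M := enorm p1 in p1max.
have KM : K `<=` disk 0 M by move=> q /mem_set /p1max; rewrite /disk/= subr0.
pose E := (K `*` `[0, M]%classic) `&`
  \bigcap_(u in [set u : 'cV[R]_2 | enorm u <= 1])
     (fun z : 'cV[R]_2 * R => z.1 + z.2 *: u) @^-1` K.
have cE : compact E.
  apply: compact_closedI.
    by apply: compact_setX => //; exact: segment_compact.
  apply: closed_bigI => u _; apply: preimage_closed.
    move=> z _; apply: cvgD; first exact: cvg_fst.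
    by apply: cvgZr_tmp; exact: cvg_snd.
  by apply: compact_closed => //; exact: norm_hausdorff.
have inE c s : 0 <= s -> disk c s `<=` K -> E (c, s).
  move=> s0 sub; split; last by move=> u u1; apply: (disk_subP _ _ s0).1.
  split=> /=.
    by apply: sub; rewrite /disk/= subrr enorm0.
  rewrite in_itv/= s0/=; apply: (disk_radius_le (c := c) (c' := 0)) => //.
  exact: subset_trans KM.
have [||z /set_mem Ez zmax] := @compact_EVT_max _ _ snd E _ cE.
(* The disk of radius 0 at a point of [K] shows that [E] is nonempty. *)
- exists (p0, 0); apply: inE => // q /enorm_eq0 /eqP.
  by rewrite subr_eq0 => /eqP ->.
- by apply: continuous_subspaceT; exact: snd_continuous.
have z0 : 0 <= z.2 by case: Ez => -[_ /=]; rewrite in_itv/= => /andP[].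
exists z.2; split.
  split => //; exists z.1; apply/(disk_subP _ _ z0) => u u1.
  by case: Ez => _; apply.
by move=> s [s0 [c cs]]; apply: (zmax (c, s)); apply/mem_set/inE.
Qed.

Lemma compact_outer_radius K :
  compact K -> K !=set0 -> exists r, is_outer_radius K r.
Proof.
move=> cK [p0 Kp0].
have [p1 Kp1 p1max] : exists2 p1, p1 \in K &
    forall t, t \in K -> enorm (t - p0) <= enorm (p1 - p0).
  apply: compact_EVT_max => //; first by exists p0.
  apply: continuous_subspaceT => z.
  apply: (continuous_comp (f := fun z : 'cV[R]_2 => z - p0)).
    by apply: continuousB; [exact: cvg_id|exact: cst_continuous].
  exact: enorm_continuous.
(* The disk of radius [M] around [p0] contains [K], so only radii up to [M] compete. Their centers
   lie within [M] of [p0], hence in the box [B], and the minimum is taken over a compact set. *)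
set M := enorm (p1 - p0) in p1max.
pose B := [set v : 'cV[R]_2 | forall i, `|v i 0| <= M + enorm p0].
pose E := (B `*` `[0, M]%classic) `&`
  \bigcap_(p in K) [set z : 'cV[R]_2 * R | enorm (p - z.1) <= z.2].
have cE : compact E.
  apply: compact_closedI.
    by apply: compact_setX; [exact: cV_box_compact|exact: segment_compact].
  apply: closed_bigI => p _; apply: closed_preimage_le.
    exact: enorm_center_continuous.
  exact: snd_continuous.
have inE c s : 0 <= s -> s <= M -> K `<=` disk c s -> E (c, s).
  move=> s0 sM sub; split; last exact: sub.
  split; last by rewrite /= in_itv/= s0.
  move=> i /=; have := le_trans (coord_le_enorm _ i) (sub _ Kp0).
  have := coord_le_enorm p0 i; rewrite !mxE => p0i ci.
  have -> : c i 0 = p0 i 0 - (p0 i 0 - c i 0) by rewrite subKr.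
  rewrite (le_trans (ler_normB _ _))// addrC lerD// (le_trans ci)//.
have Ep0 : E (p0, M).
  by apply: inE => //; [exact: enorm_ge0|move=> q /mem_set /p1max].
have [||z /set_mem Ez zmin] := @compact_EVT_min _ _ snd E _ cE.
- by exists (p0, M).
- by apply: continuous_subspaceT; exact: snd_continuous.
have z0 : 0 <= z.2 by case: Ez => -[_ /=]; rewrite in_itv/= => /andP[].
exists z.2; split.
  by split => //; exists z.1 => q Kq; case: Ez => _; apply.
move=> s [s0 [c cs]]; have [sM|/ltW Ms] := leP s M.
  by apply: (zmin (c, s)); apply/mem_set/inE.
by apply: le_trans Ms; apply: (zmin (p0, M)); exact: mem_set.
Qed.

End Radii.

(** * Matrices with orthonormal rows of zero sum *)

Section CenteredFrame.
Context {R : realType} {m n : nat}.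
Variable P : 'M[R]_(m, n).
Hypothesis P_orth : P *m P^T = 1%:M.
Hypothesis P_centered : P *m const_mx 1 = 0 :> 'cV[R]_m.

(* The difference between the Gram matrix of the columns of [P] and the
   projection [1 - J / n] has nonnegative squared row norms. *)
Lemma frame_col_bound j : \sum_(i < m) P i j ^+ 2 <= 1 - n%:R^-1.
Proof.
pose G := P^T *m P.
have Gjj : G j j = \sum_(i < m) P i j ^+ 2.
  by rewrite mxE; apply: eq_bigr => i _; rewrite mxE expr2.
have GT k l : G k l = G l k.
  by rewrite !mxE; apply: eq_bigr => i _; rewrite !mxE mulrC.
have G2 : \sum_(k < n) G j k ^+ 2 = G j j.
  have GG : G *m G = G by rewrite /G mulmxA -(mulmxA P^T) P_orth mulmx1.
  rewrite -[in RHS]GG mxE; apply: eq_bigr => k _.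
  by rewrite expr2 (GT k j).
have G1 : \sum_(k < n) G j k = 0.
  have /colP/(_ j) : G *m const_mx 1 = 0 :> 'cV_n.
    by rewrite /G -mulmxA P_centered mulmx0.
  rewrite mxE [RHS]mxE => GE; rewrite -[RHS]GE; apply: eq_bigr => k _.
  by rewrite [const_mx _ _ _]mxE mulr1.
have n0 : n%:R != 0 :> R.
  by rewrite pnatr_eq0 -lt0n (leq_trans _ (ltn_ord j)).
have : 0 <= \sum_(k < n) (G j k + n%:R^-1 - (j == k)%:R) ^+ 2.
  by apply: sumr_ge0 => k _; exact: sqr_ge0.
(* The square is expanded without its Kronecker term, whose effect is the correction at [k = j]. The
   total is [1 - 1/n - G j j]. *)
rewrite (eq_bigr (fun k => G j k ^+ 2 + 2 / n%:R * G j k + n%:R^-2 +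
   (if k == j then 1 - 2 * G j j - 2 / n%:R else 0))); last first.
  move=> k _; rewrite eq_sym; case: eqVneq => [->|_] /=.
    by field.
  by field.
rewrite !big_split/= -mulr_sumr G2 G1 -big_mkcond big_pred1_eq.
rewrite sumr_const card_ord -[n%:R^-2 *+ n]mulr_natl.
have -> : n%:R * n%:R ^- 2 = n%:R^-1 :> R by field.
by rewrite -Gjj; lra.
Qed.

(** Write [p_j] for the columns of [P]. Then [|y|^2] is the [l]-weighted mean of the inner products
    [<p_j, y>], each at most [(|p_j|^2 + |y|^2) / 2]; the term [|y|^2 / 2] is then absorbed on the
    left. *)
Lemma simplex_image_bound l : @simplex R n l ->
  \sum_(i < m) (P *m l) i 0 ^+ 2 <= 1 - n%:R^-1.
Proof.
move=> [l1 l0]; set y := P *m l; set Y := (X in X <= _).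
suff : Y <= (1 - n%:R^-1 + Y) / 2 by lra.
have YE : Y = \sum_(j < n) l j 0 * \sum_(i < m) P i j * y i 0.
  under [RHS]eq_bigr do rewrite mulr_sumr.
  rewrite exchange_big/=; apply: eq_bigr => i _.
  rewrite expr2 {1}/y mxE mulr_suml; apply: eq_bigr => j _; ring.
rewrite [leLHS]YE; set b := leRHS; have -> : b = \sum_(j < n) l j 0 * b.
  by rewrite -mulr_suml l1 mul1r.
apply: ler_sum => j _.
apply: ler_wpM2l => //.
apply: le_trans (_ : (\sum_(i < m) P i j ^+ 2 + Y) / 2 <= _); last first.
  by have := frame_col_bound j; rewrite /b; lra.
rewrite -big_split/= mulr_suml; apply: ler_sum => i _.
by have := sqr_ge0 (P i j - y i 0); nra.
Qed.

(* A preimage of [y] in the simplex is the barycentre shifted by [P^T y]. *)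
Lemma simplex_image_contains (y : 'cV[R]_m) : (1 < n)%N ->
  \sum_(i < m) y i 0 ^+ 2 <= 1 / (n%:R * (n%:R - 1)) ->
  exists2 l, @simplex R n l & P *m l = y.
Proof.
move=> n1 yle; have n1R : 1 < n%:R :> R by rewrite ltr1n.
have n0 : n%:R != 0 :> R by rewrite pnatr_eq0 -lt0n ltnW.
have n10 : n%:R - 1 != 0 :> R by rewrite subr_eq0 gt_eqF.
exists (n%:R^-1 *: const_mx 1 + P^T *m y); last first.
  by rewrite mulmxDr -scalemxAr P_centered scaler0 add0r mulmxA P_orth mul1mx.
split.
  under eq_bigr do rewrite mxE.
  rewrite big_split/= (eq_bigr (fun=> n%:R^-1)); last by move=> i _; rewrite !mxE mulr1.
  rewrite sumr_const card_ord -[n%:R^-1 *+ n]mulr_natl mulfV//.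
  suff -> : \sum_(i < n) (P^T *m y) i 0 = 0 by rewrite addr0.
  have yE : ((P *m (const_mx 1 : 'cV[R]_n))^T *m y) 0 0 = 0.
    by rewrite P_centered trmx0 mul0mx mxE.
  rewrite -[RHS]yE trmx_mul -mulmxA mxE; apply: eq_bigr => i _.
  by rewrite !mxE mul1r.
move=> j; rewrite !mxE mulr1; set t := \sum_(k < _) _.
(* The weight [n - 1] comes from the extremal case [y = - p_j / (n - 1)] with [|p_j|^2 = 1 - 1/n],
   where [|y|^2 = 1 / (n (n - 1))]. *)
have : 0 <= \sum_(i < m) (P i j + (n%:R - 1) * y i 0) ^+ 2.
  by apply: sumr_ge0 => i _; exact: sqr_ge0.
rewrite (eq_bigr (fun i => P i j ^+ 2 + 2 * (n%:R - 1) * (P^T j i * y i 0)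
   + (n%:R - 1) ^+ 2 * y i 0 ^+ 2)); last by move=> i _; rewrite mxE; ring.
rewrite !big_split/= -!mulr_sumr -/t => h.
have yle' := ler_wpM2l (sqr_ge0 (n%:R - 1)) yle.
(* The bounds on [|p_j|^2] and on [(n - 1)^2 |y|^2] are both [(n - 1) / n]; together they supply the
   term [2 (n - 1) / n]. *)
have tE : 0 <= 2 * (n%:R - 1) * (n%:R^-1 + t).
  apply: le_trans h _.
  apply: le_trans (lerD (lerD (frame_col_bound j) (lexx _)) yle') _.
  rewrite le_eqVlt; apply/orP; left; apply/eqP; field; exact/andP.
by rewrite pmulr_rge0 in tE => //; rewrite mulr_gt0// subr_gt0.
Qed.

End CenteredFrame.

(** * The reference polygon and the singular value decomposition *)

Section ReferencePolygon.
Context {R : realType} {n : nat}.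
Variable n_ge2 : (2 <= n)%N.
Implicit Types (x : 'I_n -> 'cV[R]_2) (U : 'M[R]_2) (V : 'M[R]_n).

Lemma ref_mx_orth U V : orthogonal_mx U -> orthogonal_mx V ->
  ref_mx n_ge2 U V *m (ref_mx n_ge2 U V)^T = 1%:M.
Proof.
move=> U1 V1; rewrite /ref_mx; set W := \matrix_i _.
have WW : W *m W^T = 1%:M.
  apply/matrixP => i j.
  have /matrixP/(_ (widen_ord n_ge2 i) (widen_ord n_ge2 j)) := V1.
  rewrite !mxE => <-.
  by apply: eq_bigr => k _; rewrite !mxE.
by rewrite trmx_mul mulmxA -(mulmxA U) WW mulmx1; exact: mulmx1C.
Qed.

(** Thin form of the decomposition: [Sigma_mx] vanishes beyond its first two columns, so only the
    first two columns of [V] survive. *)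
Lemma centered_mx_svd x U V (s1 s2 : R) :
  is_svd (centered_mx x) U s1 s2 V ->
  centered_mx x = U *m diag_mx (\row_i if i == 0 then s1 else s2)
                    *m \matrix_(i < 2) (col (widen_ord n_ge2 i) V)^T.
Proof.
case=> _ _ _ ->; rewrite -!mulmxA; congr (U *m _).
apply/matrixP => i j; rewrite mul_diag_mx !mxE.
rewrite (bigD1 (widen_ord n_ge2 i))//= !mxE eqxx big1 ?addr0// => k ki.
by rewrite !mxE ifN ?mul0r//; apply: contra ki => /eqP ik; apply/eqP/val_inj.
Qed.

Lemma centered_mx1 x : centered_mx x *m const_mx 1 = 0 :> 'cV_2.
Proof.
have n0 : n%:R != 0 :> R by rewrite pnatr_eq0 -lt0n ltnW.
apply/colP => i; rewrite !mxE.
rewrite (eq_bigr (fun j => x j i 0 - arith_center x i 0)); last first.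
  by move=> j _; rewrite !mxE mulr1.
rewrite big_split/= sumr_const card_ord mxE summxE -[(- _) *+ n]mulr_natl.
by rewrite mulrN mulVKf// subrr.
Qed.

(** If [s2 = 0], every vertex lies on the line through the arithmetic center directed by the first
    column of [U], so the first three vertices are collinear. *)
Lemma svd_nondegenerate x U V (s1 s2 : R) : (3 <= n)%N ->
  nondegenerate_ngon x -> is_svd (centered_mx x) U s1 s2 V -> 0 < s2.
Proof.
move=> n3 xnd xsvd; have [U1 _ /andP[s20 _] _] := xsvd.
rewrite lt_neqAle s20 andbT; apply/eqP => s2E.
have := centered_mx_svd xsvd; set W := \matrix_i _ => BE.
apply: (xnd (Ordinal (ltnW (ltnW n3))) (Ordinal (ltnW n3)) (Ordinal n3)) => //.
exists (arith_center x), (col 0 U); split.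
  apply/eqP => U0; have /matrixP/(_ 0 0) := U1.
  rewrite !mxE big1 => [/eqP|k _]; first by rewrite eq_sym oner_eq0.
  by have /colP/(_ k) := U0; rewrite !mxE => ->; rewrite mulr0.
have xE j : exists t : R, x j = arith_center x + t *: col 0 U.
  exists (s1 * W 0 j); apply/colP => i.
  have /matrixP/(_ i j) := BE.
  rewrite -mulmxA mxE [in X in _ = X]mxE big_ord_recl big_ord1.
  rewrite !mul_diag_mx !mxE/= -s2E mul0r mulr0 addr0 => h.
  by rewrite [_ * U i 0]mulrC -[LHS](subrKC (n%:R^-1 * (\sum_k x k) i 0)) h.
by move=> q; rewrite !inE => /or3P[] /eqP ->; exact: xE.
Qed.

(** The zero row sums of the centered matrix pass to [P] by cancelling [U] and then the diagonal
    factor, which is invertible because [0 < s2 <= s1]. *)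
Lemma ref_mx_centered x U V (s1 s2 : R) : (3 <= n)%N ->
  nondegenerate_ngon x -> is_svd (centered_mx x) U s1 s2 V ->
  ref_mx n_ge2 U V *m const_mx 1 = 0 :> 'cV_2.
Proof.
move=> n3 xnd xsvd; have s2_gt0 := svd_nondegenerate n3 xnd xsvd.
have [U1 _ /andP[_ s21] _] := xsvd.
have BE := centered_mx_svd xsvd.
rewrite /ref_mx; move: BE; set W := \matrix_i _ => BE.
have := centered_mx1 x; rewrite BE -!mulmxA => /(congr1 (mulmx U^T)).
rewrite mulmxA U1 mul1mx mulmx0 => D0.
suff -> : W *m const_mx 1 = 0 :> 'cV_2 by rewrite mulmx0.
apply/colP => i; have /colP/(_ i)/eqP := D0.
rewrite mul_diag_mx mxE [in X in _ == X]mxE mulf_eq0 mxE => /orP[|/eqP->].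
  by case: ifP => _; rewrite gt_eqF// (lt_le_trans s2_gt0).
by rewrite mxE.
Qed.

Lemma ref_polygon_compact U V : compact (ref_polygon n_ge2 U V).
Proof.
rewrite /ref_polygon; set P := ref_mx _ _ _.
have -> : [set P *m l | l in @simplex R n] =
    [set \sum_(j < n) l j 0 *: col j P | l in simplex].
  suff PE (l : 'cV[R]_n) : P *m l = \sum_(j < n) l j 0 *: col j P.
    by apply/seteqP; split=> _ [l sl <-]; exists l.
  apply/colP => i; rewrite mxE summxE; apply: eq_bigr => j _.
  by rewrite !mxE mulrC.
exact: simplex_image_compact.
Qed.

End ReferencePolygon.

(** * Bounds on the two radii and on their ratio *)

Theorem proposition2p10 (R : realType) (n : nat) (n_ge3 : (3 <= n)%N)
    (T : set 'cV[R]_2) (x : 'I_n -> 'cV[R]_2)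
    (T_ngon : convex_ngon T x) (T_nondeg : nondegenerate_ngon x)
    (U : 'M[R]_2) (s1 s2 : R) (V : 'M[R]_n)
    (B_svd : is_svd (centered_mx x) U s1 s2 V) :
  let K := ref_polygon (ltnW n_ge3) U V in
  exists r_in r_out : R,
    [/\ is_in_radius K r_in, is_outer_radius K r_out,
        Num.sqrt (1 / (n%:R * (n%:R - 1))) <= r_in,
        r_out <= Num.sqrt ((n%:R - 1) / n%:R)
      & 1 <= r_out / r_in <= n%:R - 1].
Proof.
move=> K; have [U1 V1 _ _] := B_svd.
have PP := ref_mx_orth (ltnW n_ge3) U1 V1.
have P1 := ref_mx_centered (ltnW n_ge3) n_ge3 T_nondeg B_svd.
have n1R : 1 < n%:R :> R by rewrite ltr1n ltnW.
have n0R : 0 < n%:R :> R by apply: lt_trans n1R.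
have inn0 : 0 < 1 / (n%:R * (n%:R - 1)) :> R.
  by rewrite divr_gt0// mulr_gt0// subr_gt0.
set rho := Num.sqrt (1 / _); set sigma := Num.sqrt (_ / n%:R).
have rho_gt0 : 0 < rho by rewrite sqrtr_gt0.
(* This identity turns the two radius bounds into the ratio bound [n - 1]. *)
have sigmaE : sigma = (n%:R - 1) * rho.
  rewrite -[n%:R - 1 in RHS]ger0_norm ?subr_ge0 ?ltW//.
  rewrite -sqrtr_sqr -sqrtrM ?sqr_ge0//.
  by congr Num.sqrt; field; rewrite !gt_eqF// subr_gt0.
have rhoK : disk 0 rho `<=` K.
  move=> y; rewrite /disk/= subr0 => yrho.
  have [|l sl ly] := simplex_image_contains PP P1 (y := y) (ltnW n_ge3);
    last by exists l.
  rewrite -sqr_enorm -[leRHS](sqr_sqrtr (ltW inn0)).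
  by rewrite ler_pXn2r// nnegrE ?enorm_ge0// ltW.
have Ksigma : K `<=` disk 0 sigma.
  move=> _ [l sl <-]; rewrite /disk/= subr0 ler_wsqrtr//.
  apply: le_trans (simplex_image_bound PP P1 sl) _.
  by rewrite mulrBl mulfV ?gt_eqF// mul1r.
have cK : compact K by exact: ref_polygon_compact.
have K0 : K !=set0.
  by exists 0; apply: rhoK; rewrite /disk/= subr0 enorm0 ltW.
have [r_in rin] := compact_in_radius cK K0.
have [r_out rout] := compact_outer_radius cK K0.
have rho_in : rho <= r_in by apply: rin.2; split; [exact: ltW|exists 0].
have out_sigma : r_out <= sigma.
  by apply: rout.2; split; [exact: sqrtr_ge0|exists 0].
have in_gt0 : 0 < r_in by apply: lt_le_trans rho_in.
exists r_in, r_out; split => //; apply/andP; split.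
  rewrite ler_pdivlMr// mul1r.
  (* An inscribed disk of radius [r_in] lies in [K], hence in an enclosing disk of radius
     [r_out]. *)
  case: rin.1 => _ [c cK1]; case: rout.1 => _ [c' cK2].
  exact: (disk_radius_le (ltW in_gt0) (subset_trans cK1 cK2)).
rewrite ler_pdivrMr// (le_trans out_sigma)// sigmaE ler_wpM2l//.
by rewrite subr_ge0 ltW.
Qed.
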